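(* Let $M_b\in\{0,1\}^{m\times n}$ be the adjacency matrix of a bipartite graph $G_b$ in which every vertex is connected to at least one other vertex, and let $S_d$, $F$ and $B$ be the sets of matrices defined in the context. For $d>\max(m,n)-1$ (with $d>0$), $$F\cap S_d=B .$$
   Context: Let $M_d=(1+d)M_b-d\,\mathbf 1_{m\times n}$ with $d>0$, where $\mathbf 1_{m\times n}$ is the all-ones matrix; thus $M_d$ is $M_b$ with its zero entries replaced by $-d$. Here $v$ denotes a column vector in $\mathbb{R}^m$ and $w$ a row vector in $\mathbb{R}^n$, so $vw\in\mathbb{R}^{m\times n}$; maxima are entrywise. $S_d$ is the set of nonzero matrices $vw\in\mathbb{R}^{m\times n}$ such that $v,w\ne\mathbf 0$ satisfy $$v=\max\Big(\mathbf 0,\frac{M_dw^T}{\|w\|_2^2}\Big)\quad\text{and}\quad w=\max\Big(\mathbf 0,\frac{v^TM_d}{\|v\|_2^2}\Big);$$ these are the nontrivial stationary (KKT) points of $\min_{v\ge\mathbf 0,\,w\ge\mathbf 0}\|M_d-vw\|_F^2$. $F$ is the set of matrices $vw$ with $v\in\{0,1\}^m$, $w\in\{0,1\}^n$ and $v_iw_j\le M_b(i,j)$ for all $i,j$; such $(v,w)$ correspond to bicliques (complete bipartite subgraphs) of $G_b$, with vertex sets $\{i: v_i=1\}$ and $\{j: w_j=1\}$. $B$ is the set of those $vw\in F$ which correspond to maximal bicliques of $G_b$, i.e. bicliques (with $v,w\neq\mathbf 0$) that are not contained in a larger biclique of $G_b$. *)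

(* Defs.v *)
From HB Require Import structures.
From mathcomp Require Import all_boot all_order all_algebra.
From mathcomp Require Import classical_sets reals.

Set Implicit Arguments.
Unset Strict Implicit.
Unset Printing Implicit Defensive.
Import Order.TTheory GRing.Theory Num.Theory.
Local Open Scope classical_set_scope.
Local Open Scope ring_scope.

(* A bipartite graph with parts 'I_m and 'I_n is given by the relation
   G : 'I_m -> 'I_n -> bool of adjacency between the two parts. *)

Definition no_isolated_vertex m n (G : 'I_m -> 'I_n -> bool) : Prop :=
  (forall i, exists j, G i j) /\ (forall j, exists i, G i j).

Definition biadjacency (R : realType) m n (G : 'I_m -> 'I_n -> bool) :
    'M[R]_(m, n) :=
  \matrix_(i < m, j < n) (G i j)%:R.

Definition biclique m n (G : 'I_m -> 'I_n -> bool)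
    (I : {set 'I_m}) (J : {set 'I_n}) : Prop :=
  forall i j, i \in I -> j \in J -> G i j.

(* Since I and J are nonempty, every biclique containing (I, J) has two
   nonempty sides, so the larger bicliques need no nonemptiness condition. *)
Definition maximal_biclique m n (G : 'I_m -> 'I_n -> bool)
    (I : {set 'I_m}) (J : {set 'I_n}) : Prop :=
  [/\ I != finset.set0, J != finset.set0, biclique G I J &
      forall (I' : {set 'I_m}) (J' : {set 'I_n}),
        I \subset I' -> J \subset J' -> biclique G I' J' -> I' = I /\ J' = J].

Definition norm2 (R : realType) p q (A : 'M[R]_(p, q)) : R :=
  Num.sqrt (\sum_(i < p) \sum_(j < q) A i j ^+ 2).

Definition zero_one (R : realType) p q (A : 'M[R]_(p, q)) : Prop :=
  forall i j, A i j = 0 \/ A i j = 1.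

Definition Md (R : realType) m n (Mb : 'M[R]_(m, n)) (d : R) : 'M[R]_(m, n) :=
  (1 + d) *: Mb - d *: const_mx 1.

Definition stationary_pair (R : realType) m n (M : 'M[R]_(m, n))
    (v : 'cV[R]_m) (w : 'rV[R]_n) : Prop :=
  v = map2_mx Num.max 0 ((norm2 w ^+ 2)^-1 *: (M *m w^T)) /\
  w = map2_mx Num.max 0 ((norm2 v ^+ 2)^-1 *: (v^T *m M)).

Definition S_ (R : realType) m n (Mb : 'M[R]_(m, n)) (d : R) :
    set 'M[R]_(m, n) :=
  [set A | A <> 0 /\ exists (v : 'cV[R]_m) (w : 'rV[R]_n),
    [/\ A = v *m w, v <> 0, w <> 0 & stationary_pair (Md Mb d) v w]].

Definition biclique_pair (R : realType) m n (Mb : 'M[R]_(m, n))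
    (v : 'cV[R]_m) (w : 'rV[R]_n) : Prop :=
  [/\ zero_one v, zero_one w & forall i j, v i 0 * w 0 j <= Mb i j].

Definition F_ (R : realType) m n (Mb : 'M[R]_(m, n)) : set 'M[R]_(m, n) :=
  [set A | exists (v : 'cV[R]_m) (w : 'rV[R]_n),
    A = v *m w /\ biclique_pair Mb v w].

Definition B_ (R : realType) m n (G : 'I_m -> 'I_n -> bool) :
    set 'M[R]_(m, n) :=
  [set A | exists (v : 'cV[R]_m) (w : 'rV[R]_n),
    [/\ A = v *m w, biclique_pair (biadjacency R G) v w &
        maximal_biclique G [set i | v i 0 == 1]%SET [set j | w 0 j == 1]%SET]].
Arguments B_ R {m n} G.

(* Main.v *)
(** At a stationary pair, a row vertex adjacent to the whole support of [w]
    gets a positive weight in [M_d w^T], hence belongs to the support of [v];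
    so the supports form a maximal biclique. Conversely, when [w] is the
    indicator of [J], a row vertex missing a neighbour in [J] gets weight at
    most [(n - 1) - d < 0], so the positive part vanishes off the biclique,
    whereas the vertices adjacent to all of [J] get weight exactly
    [#|J| = norm2 w ^+ 2]. *)
Require Import Defs.
From mathcomp Require Import all_boot all_order all_algebra.
From mathcomp Require Import classical_sets reals.
Set Implicit Arguments.
Unset Strict Implicit.
Unset Printing Implicit Defensive.
Local Open Scope classical_set_scope.
Local Open Scope ring_scope.
Import Order.TTheory GRing.Theory Num.Theory.

(** One of the two stationarity equations, kept apart so that the equation for [w] becomes the same
    one for [M^T], with [w^T] and [v^T] exchanging roles. Each argument is then made for rows
    only. *)
Definition half_stationary (R : realType) m n (M : 'M[R]_(m, n))
    (v : 'cV[R]_m) (w : 'rV[R]_n) : Prop :=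
  v = map2_mx Num.max 0 ((norm2 w ^+ 2)^-1 *: (M *m w^T)).

Lemma norm2_sqr (R : realType) p q (A : 'M[R]_(p, q)) :
  norm2 A ^+ 2 = \sum_(i < p) \sum_(j < q) A i j ^+ 2.
Proof.
rewrite /norm2 sqr_sqrtr //.
by apply: sumr_ge0 => i _; apply: sumr_ge0 => j _; apply: sqr_ge0.
Qed.

Lemma norm2_trmx (R : realType) p q (A : 'M[R]_(p, q)) : norm2 A^T = norm2 A.
Proof.
rewrite /norm2 exchange_big /=; congr (Num.sqrt _).
by apply: eq_bigr => i _; apply: eq_bigr => j _; rewrite mxE.
Qed.

Lemma norm2_sqr_gt0 (R : realType) p q (A : 'M[R]_(p, q)) :
  A <> 0 -> 0 < norm2 A ^+ 2.
Proof.
move=> A0; rewrite norm2_sqr lt0r.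
have sq0 i : 0 <= \sum_(j < q) A i j ^+ 2.
  by apply: sumr_ge0 => j _; apply: sqr_ge0.
rewrite sumr_ge0 // andbT; apply/eqP => /eqP.
rewrite psumr_eq0 // => /allP s0; apply: A0; apply/matrixP => i j.
have /= := s0 i (mem_index_enum _).
rewrite psumr_eq0; last by move=> k _; apply: sqr_ge0.
by move=> /allP /(_ j (mem_index_enum _)) /=; rewrite sqrf_eq0 mxE => /eqP.
Qed.

Lemma half_stationary_trmx (R : realType) m n (M : 'M[R]_(m, n)) v w :
  half_stationary M^T w^T v^T <->
  w = map2_mx Num.max 0 ((norm2 v ^+ 2)^-1 *: (v^T *m M)).
Proof.
rewrite /half_stationary norm2_trmx -trmx_mul -linearZ /=.
set B := _ *: _; have -> : map2_mx Num.max 0 B^T = (map2_mx Num.max 0 B)^T.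
  by apply/matrixP => i j; rewrite !mxE.
by split=> [/trmx_inj|->].
Qed.

Lemma stationary_pairE (R : realType) m n (M : 'M[R]_(m, n)) v w :
  stationary_pair M v w <->
  half_stationary M v w /\ half_stationary M^T w^T v^T.
Proof. by rewrite half_stationary_trmx. Qed.

Lemma half_stationary_entry (R : realType) m n (M : 'M[R]_(m, n)) v w :
  half_stationary M v w <->
  forall i, v i 0 = Num.max 0 ((norm2 w ^+ 2)^-1 * \sum_j M i j * w 0 j).
Proof.
have sumE i : (M *m w^T) i 0 = \sum_j M i j * w 0 j.
  by rewrite mxE; apply: eq_bigr => j _; rewrite mxE.
split=> [-> i|vE]; first by rewrite !mxE -sumE mxE.
by apply/colP => i; rewrite vE -sumE !mxE.
Qed.

Lemma half_stationary_ge0 (R : realType) m n (M : 'M[R]_(m, n)) v w :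
  half_stationary M v w -> forall i, 0 <= v i 0.
Proof. by move=> /half_stationary_entry vE i; rewrite vE le_max lexx. Qed.

Lemma Md_biadjacencyE (R : realType) m n (G : 'I_m -> 'I_n -> bool) (d : R) i j :
  Md (biadjacency R G) d i j = if G i j then 1 else - d.
Proof.
by rewrite !mxE mulr1; case: (G i j); rewrite ?mulr1 ?mulr0 ?addrK ?sub0r.
Qed.

Lemma Md_biadjacency_trmx (R : realType) m n (G : 'I_m -> 'I_n -> bool) (d : R) :
  (Md (biadjacency R G) d)^T = Md (biadjacency R (fun j i => G i j)) d.
Proof. by apply/matrixP => i j; rewrite mxE !Md_biadjacencyE. Qed.

(** Every entry [-d] in row [i] meets a zero of [w], so the row's weight is just the sum of the
    entries of [w], which is positive for a nonzero nonnegative vector. *)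
Lemma half_stationary_gt0 (R : realType) m n (G : 'I_m -> 'I_n -> bool) (d : R)
    (v : 'cV[R]_m) (w : 'rV[R]_n) i :
  half_stationary (Md (biadjacency R G) d) v w ->
  w <> 0 -> (forall j, 0 <= w 0 j) -> (forall j, w 0 j != 0 -> G i j) ->
  0 < v i 0.
Proof.
move=> /half_stationary_entry vE w0 wge0 wG.
have -> : v i 0 = Num.max 0 ((norm2 w ^+ 2)^-1 * \sum_j w 0 j).
  rewrite vE; congr (Num.max _ (_ * _)); apply: eq_bigr => j _.
  have [->|/wG Gij] := eqVneq (w 0 j) 0; first by rewrite mulr0.
  by rewrite Md_biadjacencyE Gij mul1r.
rewrite lt_max ltxx /= mulr_gt0 ?invr_gt0 ?norm2_sqr_gt0 //.
rewrite lt0r sumr_ge0 // andbT; apply/eqP => /eqP.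
rewrite psumr_eq0 // => /allP s0; apply: w0; apply/rowP => j.
by rewrite mxE; apply/eqP/(s0 j (mem_index_enum _)).
Qed.

Lemma half_stationary_indicator (R : realType) m n (G : 'I_m -> 'I_n -> bool)
    (d : R) (I : {set 'I_m}) (J : {set 'I_n}) (v : 'cV[R]_m) (w : 'rV[R]_n) :
  n%:R - 1 < d -> J != finset.set0 ->
  (forall i, v i 0 = (i \in I)%:R) -> (forall j, w 0 j = (j \in J)%:R) ->
  (forall i, (i \in I) = [forall (j | j \in J), G i j]) ->
  half_stationary (Md (biadjacency R G) d) v w.
Proof.
move=> nd J0 vI wJ IJ; apply/half_stationary_entry => i.
have sumJ (F : 'I_n -> R) : \sum_j F j * w 0 j = \sum_(j in J) F j.
  rewrite [RHS]big_mkcond; apply: eq_bigr => j _.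
  by rewrite wJ; case: (j \in J); rewrite ?mulr1 ?mulr0.
have normJ : norm2 w ^+ 2 = #|J|%:R.
  rewrite norm2_sqr big_ord1 -sum1_card natr_sum -sumJ.
  apply: eq_bigr => j _; rewrite mul1r wJ.
  by case: (j \in J); rewrite ?expr1n ?expr0n.
have J_gt0 : 0 < #|J|%:R :> R by rewrite ltr0n card_gt0.
rewrite normJ sumJ vI IJ; case: forall_inP => [allG|/forall_inP].
  rewrite (eq_bigr (fun=> 1)); last by move=> j jJ; rewrite Md_biadjacencyE allG.
  by rewrite sumr_const mulVf ?gt_eqF // max_r.
rewrite negb_forall => /existsP[j0]; rewrite negb_imply => /andP[j0J nG].
(* The missing edge at [j0] contributes [-d]; it remains to bound the rest of the sum over [J] by
   [n - 1]. *)
rewrite max_l // pmulr_rle0 ?invr_gt0 // (bigD1 j0) //=.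
rewrite Md_biadjacencyE (negPf nG) addrC subr_le0 (le_trans _ (ltW nd)) //.
(* The index [j0] forces [n >= 1], so [d > n - 1 >= 0]; positivity of [d] bounds every further entry
   [-d] by 1. *)
have n_gt0 : (0 < n)%N by apply: leq_ltn_trans (ltn_ord j0).
have d_gt0 : 0 < d by rewrite (le_lt_trans _ nd) // subr_ge0 ler1n.
apply: (@le_trans _ _ (\sum_(j in J | j != j0) 1)).
  apply: ler_sum => j _; rewrite Md_biadjacencyE; case: (G i j) => //.
  by rewrite (le_trans _ ler01) // oppr_le0 ltW.
(* Moving the 1 across and reading it as the term at [j0] of a constant sum restores the full sum
   over [J], which is [#|J| <= n]. *)
rewrite lerBrDr [leLHS]addrC -[X in X + _ <= _]/((fun=> 1 : R) j0) -bigD1 //=.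
by rewrite sumr_const ler_nat (leq_trans (max_card _)) // card_ord.
Qed.

Lemma maximal_biclique_sym m n (G : 'I_m -> 'I_n -> bool) I J :
  maximal_biclique G I J -> maximal_biclique (fun j i => G i j) J I.
Proof.
case=> I0 J0 GIJ maxIJ; split=> // [j i jJ iI|J' I' JJ' II' G'].
  exact: GIJ.
by have [|-> ->] := maxIJ I' J' II' JJ'; first by move=> i j iI jJ; apply: G'.
Qed.

(** Adjoining to [I] a common neighbour of [J] leaves a biclique, so maximality already places it in
    [I]. *)
Lemma maximal_biclique_mem m n (G : 'I_m -> 'I_n -> bool) I J :
  maximal_biclique G I J ->
  forall i, (i \in I) = [forall (j | j \in J), G i j].
Proof.
case=> _ _ GIJ maxIJ i; apply/idP/forall_inP => [iI j jJ|iJ]; first exact: GIJ.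
have [|<- _] := maxIJ (i |: I)%SET J (finset.subsetUr _ _) (subxx _).
  by move=> k j /setU1P[->|kI] jJ; [apply: iJ|apply: GIJ].
exact: setU11.
Qed.

Lemma zero_one_entry (R : realType) p q (A : 'M[R]_(p, q)) i j :
  zero_one A -> A i j = (A i j == 1)%:R.
Proof. by move=> /(_ i j)[]->; rewrite ?eqxx // eq_sym oner_eq0. Qed.

Lemma biclique_pair_biclique (R : realType) m n (G : 'I_m -> 'I_n -> bool)
    (v : 'cV[R]_m) (w : 'rV[R]_n) :
  biclique_pair (biadjacency R G) v w ->
  biclique G [set i | v i 0 == 1]%SET [set j | w 0 j == 1]%SET.
Proof.
case=> _ _ vwG i j; rewrite !inE => /eqP vi /eqP wj.
by have := vwG i j; rewrite vi wj mulr1 mxE; case: (G i j); rewrite // ler10.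
Qed.

(** The binary factors and the stationary factors of the matrix may differ, for instance by a
    scaling. A nonzero product nevertheless determines the supports of its factors, so positivity of
    [v'] and [w'] carries over to [v] and [w]. *)
Lemma stationary_maximal_biclique (R : realType) m n
    (G : 'I_m -> 'I_n -> bool) (d : R)
    (v v' : 'cV[R]_m) (w w' : 'rV[R]_n) :
  biclique_pair (biadjacency R G) v w ->
  stationary_pair (Md (biadjacency R G) d) v' w' ->
  v' *m w' = v *m w -> v *m w <> 0 ->
  maximal_biclique G [set i | v i 0 == 1]%SET [set j | w 0 j == 1]%SET.
Proof.
move=> vwG /stationary_pairE[]; rewrite Md_biadjacency_trmx => sv sw eqA A0.
have GIJ := biclique_pair_biclique vwG; case: vwG => v01 w01 _.
have mulE (a : 'cV[R]_m) (b : 'rV[R]_n) i j : (a *m b) i j = a i 0 * b 0 j.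
  by rewrite mxE big_ord1.
have eqE i j : v' i 0 * w' 0 j = v i 0 * w 0 j by rewrite -!mulE eqA.
have /existsP[i0 /existsP[j0]] : [exists i, exists j, (v *m w) i j != 0].
  apply: contra_notT A0; rewrite negb_exists => /forallP A0.
  apply/matrixP => i j; rewrite [RHS]mxE; apply/eqP.
  by have := A0 i; rewrite negb_exists => /forallP/(_ j); rewrite negbK.
rewrite mulE mulf_eq0 negb_or => /andP[vi0 wj0].
(* At a nonzero entry of the common product all four factors are nonzero; [i0] and [j0] then serve
   as pivots for comparing supports. *)
have /andP[vi0' wj0'] : (v' i0 0 != 0) && (w' 0 j0 != 0).
  by rewrite -negb_or -mulf_eq0 eqE mulf_neq0.
have eq1 p q (A : 'M[R]_(p, q)) i j : zero_one A -> A i j != 0 -> A i j == 1.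
  by move=> /(_ i j)[]->; rewrite ?eqxx.
have supp_v i : v' i 0 != 0 -> v i 0 == 1.
  move=> vi; apply: eq1 => //.
  by have := mulf_neq0 vi wj0'; rewrite eqE mulf_eq0 negb_or => /andP[].
have supp_w j : w' 0 j != 0 -> w 0 j == 1.
  move=> wj; apply: eq1 => //.
  by have := mulf_neq0 vi0' wj; rewrite eqE mulf_eq0 negb_or => /andP[].
have v'0 : v' <> 0 by move=> v'0; rewrite v'0 mxE eqxx in vi0'.
have w'0 : w' <> 0 by move=> w'0; rewrite w'0 mxE eqxx in wj0'.
have v'ge0 := half_stationary_ge0 sv.
have w'ge0 j : 0 <= w' 0 j by have := half_stationary_ge0 sw j; rewrite mxE.
split=> //.
- by apply/set0Pn; exists i0; rewrite inE eq1.
- by apply/set0Pn; exists j0; rewrite inE eq1.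
move=> I' J' II' JJ' G'; split; apply/eqP; rewrite finset.eqEsubset ?II' ?JJ' andbT.
(* A vertex [i] of the larger biclique is adjacent to all of [J'], which contains the support of
   [w']; hence [v' i 0 > 0] and [i] is in the support of [v]. *)
- apply/fintype.subsetP => i iI'; rewrite inE supp_v // gt_eqF //.
  apply: half_stationary_gt0 sv _ _ _ => // j /supp_w wj.
  by apply: G' => //; apply: (fintype.subsetP JJ'); rewrite inE.
- apply/fintype.subsetP => j jJ'; rewrite inE supp_w // gt_eqF //.
  have -> : w' 0 j = w'^T j 0 by rewrite mxE.
  apply: half_stationary_gt0 sw _ _ _ => [vT0|i|i].
  + by apply: v'0; rewrite -[v']trmxK vT0 trmx0.
  + by rewrite mxE.
  rewrite mxE => /supp_v vi.
  by apply: G' => //; apply: (fintype.subsetP II'); rewrite inE.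
Qed.

(** The maximum in the bound on [d] comes from the two equations: the one for rows uses [n - 1 < d],
    the one for columns [m - 1 < d]. *)
Lemma maximal_biclique_stationary (R : realType) m n
    (G : 'I_m -> 'I_n -> bool) (d : R) (v : 'cV[R]_m) (w : 'rV[R]_n) :
  (maxn m n)%:R - 1 < d -> zero_one v -> zero_one w ->
  maximal_biclique G [set i | v i 0 == 1]%SET [set j | w 0 j == 1]%SET ->
  stationary_pair (Md (biadjacency R G) d) v w.
Proof.
move=> hd v01 w01 maxIJ; have [I0 J0 _ _] := maxIJ.
have vI i : v i 0 = (i \in [set i | v i 0 == 1]%SET)%:R.
  by rewrite inE -zero_one_entry.
have wJ j : w 0 j = (j \in [set j | w 0 j == 1]%SET)%:R.
  by rewrite inE -zero_one_entry.
apply/stationary_pairE; rewrite Md_biadjacency_trmx; split.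
- apply: half_stationary_indicator J0 vI wJ (maximal_biclique_mem maxIJ).
  by apply: le_lt_trans hd; rewrite lerD2r ler_nat leq_maxr.
- apply: half_stationary_indicator I0 _ _
    (maximal_biclique_mem (maximal_biclique_sym maxIJ)).
  + by apply: le_lt_trans hd; rewrite lerD2r ler_nat leq_maxl.
  + by move=> j; rewrite mxE -wJ.
  + by move=> i; rewrite mxE -vI.
Qed.

Theorem theorem6 (R : realType) (m n : nat) (G : 'I_m -> 'I_n -> bool) (d : R)
    (hG : no_isolated_vertex G)
    (hd0 : 0 < d) (hd : (maxn m n)%:R - 1 < d) :
  F_ (biadjacency R G) `&` S_ (biadjacency R G) d = B_ R G.
Proof.
apply/seteqP; split=> A.
- case=> -[v [w [-> vwG]]] [A0 [v' [w' [eqA _ _ st]]]].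
  exists v, w; split=> //.
  exact: (stationary_maximal_biclique vwG st (esym eqA) A0).
- case=> v [w [-> vwG maxIJ]]; split; first by exists v, w.
  have [v01 w01 _] := vwG.
  (* Both sides of a maximal biclique are nonempty, so the product has an entry equal to 1 and
     neither factor vanishes. *)
  have [/set0Pn[i0] /[!inE]/eqP vi0 /set0Pn[j0] /[!inE]/eqP wj0 _ _] := maxIJ.
  split.
    move=> /matrixP/(_ i0 j0)/eqP.
    by rewrite !mxE big_ord1 vi0 wj0 mulr1 oner_eq0.
  exists v, w; split=> //.
  + by move=> v0; move/eqP: vi0; rewrite v0 mxE eq_sym oner_eq0.
  + by move=> w0; move/eqP: wj0; rewrite w0 mxE eq_sym oner_eq0.
  exact: maximal_biclique_stationary.
Qed.
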